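(* Let $G$ be a Hausdorff topological group. Suppose that for some integer $p\ge 2$ there is a nonempty open subset $\Omega$ of $G$ such that the restriction to $\Omega$ of the power map, $\Omega\ni g\mapsto g^p\in G$, is left uniformly continuous. If every Roelcke-discrete subset of $G$ is left thin in $G$, then $G$ is SIN.
   Context: Let $e$ be the unit of $G$ and $\mathcal N(e)$ the set of all neighborhoods of $e$ in $G$. The left uniformity $\mathcal U_l$ of $G$ has as a basis of entourages the sets $\{(x,y)\in G\times G: x^{-1}y\in V\}$, $V\in\mathcal N(e)$; the right uniformity $\mathcal U_r$ has as a basis of entourages the sets $\{(x,y)\in G\times G: xy^{-1}\in V\}$, $V\in\mathcal N(e)$. $G$ is SIN if $\mathcal U_l=\mathcal U_r$. A map $f:\Omega\to G$ with $\Omega\subset G$ is left uniformly continuous if it is uniformly continuous when $\Omega$ carries the uniformity induced by $\mathcal U_l$ and $G$ carries $\mathcal U_l$; i.e. for every $V\in\mathcal N(e)$ there is $W\in\mathcal N(e)$ such that $f(x)^{-1}f(y)\in V$ whenever $x,y\in\Omega$ and $x^{-1}y\in W$. A subset $A\subset G$ is left thin in $G$ if for every $V\in\mathcal N(e)$ the set $\bigcap_{a\in A}a^{-1}Va$ is a neighborhood of $e$. A subset $A\subset G$ is Roelcke-discrete if there is $V\in\mathcal N(e)$ such that $a=b$ whenever $a,b\in A$ and $a\in VbV$. *)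

(* Defs.v *)
From HB Require Import structures.
Set Warnings "-notation-overridden,-notation-incompatible-prefix".
From mathcomp Require Import all_boot.
From mathcomp Require Import boolp classical_sets functions topology.

Set Implicit Arguments.
Unset Strict Implicit.
Unset Printing Implicit Defensive.

Local Open Scope classical_set_scope.
Local Open Scope group_scope.

HB.mixin Record isTopologicalGroup G & Topological G & Group G := {
  mulg_continuous : continuous (fun xy : G * G => xy.1 * xy.2);
  invg_continuous : continuous (fun x : G => x^-1)
}.

#[short(type="topGroupType")]
HB.structure Definition TopologicalGroup :=
  {G of Topological G & Group G & isTopologicalGroup G}.

Definition left_entourage (G : topGroupType) : set_system (G * G) :=
  filter_from (nbhs (1 : G)) (fun V => [set xy | V (xy.1^-1 * xy.2)]).

Definition right_entourage (G : topGroupType) : set_system (G * G) :=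
  filter_from (nbhs (1 : G)) (fun V => [set xy | V (xy.1 * xy.2^-1)]).

Section TopologicalGroupTheory.
Context {G : topGroupType}.
Implicit Types (x y : G) (V W : set G).

Lemma continuous2_mulg (T : topologicalType) (f g : T -> G) (t : T) :
  {for t, continuous f} -> {for t, continuous g} ->
  {for t, continuous (fun s => f s * g s)}.
Proof.
move=> cf cg.
exact: (@continuous2_cvg _ _ _ _ (nbhs t) _ f g (fun a b => a * b) (f t) (g t)
          (@mulg_continuous G (f t, g t)) cf cg).
Qed.

Lemma mulgl_continuous x : continuous (fun y : G => x * y).
Proof. by move=> y; apply: continuous2_mulg => //; exact: cst_continuous. Qed.

Lemma mulgr_continuous x : continuous (fun y : G => y * x).
Proof. by move=> y; apply: continuous2_mulg => //; exact: cst_continuous. Qed.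

Lemma nbhs1_invg V : nbhs (1 : G) V -> nbhs (1 : G) [set x | V x^-1].
Proof. by move=> nV; apply: (@invg_continuous G 1); rewrite /= invg1. Qed.

Lemma nbhs1_split V : nbhs (1 : G) V ->
  exists2 W, nbhs (1 : G) W & forall x y, W x -> W y -> V (x * y).
Proof.
move=> nV.
have : nbhs ((1 : G), (1 : G)) [set xy | V (xy.1 * xy.2)].
  by apply: (@mulg_continuous G (1, 1)); rewrite /= mulg1.
case=> -[A B] /= [nA nB] AB; exists (A `&` B); first exact: filterI.
by move=> x y [Ax _] [_ By]; exact: (AB (x, y)).
Qed.

Lemma left_entourage_filter : Filter (@left_entourage G).
Proof.
apply: filter_from_filter; first by exists setT; exact: filterT.
by move=> V W nV nW; exists (V `&` W); first exact: filterI.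
Qed.

Lemma left_entourage_diagonal A : left_entourage A -> @diagonal G `<=` A.
Proof.
move=> [V nV VA] [x y] exy; apply: VA; rewrite /= (exy : x = y).
by rewrite mulVg; exact: nbhs_singleton.
Qed.

Lemma left_entourage_inv (A : set (G * G)) :
  left_entourage A -> left_entourage (A^-1)%relation.
Proof.
move=> [V nV VA]; exists [set x | V x^-1]; first exact: nbhs1_invg.
by move=> [x y] /= Vxy; apply: VA => /=; rewrite invgM invgK in Vxy.
Qed.

Lemma left_entourage_split_ex A : left_entourage A ->
  exists2 B : set (G * G), left_entourage B & (B \; B `<=` A)%relation.
Proof.
move=> [V /nbhs1_split[W nW WV] VA].
exists [set xy | W (xy.1^-1 * xy.2)]; first by exists W.
move=> [x y] /= [z /= Wxz Wzy]; apply: VA => /=.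
by rewrite -(mulVKg z y) mulgA; exact: WV.
Qed.

Lemma nbhs_left_entourage : @nbhs G G = nbhs_ (@left_entourage G).
Proof.
apply/funext => x; apply/seteqP; split=> U.
  move=> nU; exists [set xy | U (x * (xy.1^-1 * xy.2))].
    exists [set v | U (x * v)] => //.
    by apply: (@mulgl_continuous x 1); rewrite mulg1.
  by move=> y; rewrite /xsection /= inE /= mulVKg.
move=> [A [V nV VA] AU].
have : nbhs x [set y | V (x^-1 * y)].
  by apply: (@mulgl_continuous x^-1 x); rewrite mulVg.
apply: filterS => y Vxy; apply: AU; rewrite /xsection /= inE.
exact: VA.
Qed.

Lemma right_entourage_filter : Filter (@right_entourage G).
Proof.
apply: filter_from_filter; first by exists setT; exact: filterT.
by move=> V W nV nW; exists (V `&` W); first exact: filterI.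
Qed.

Lemma right_entourage_diagonal A : right_entourage A -> @diagonal G `<=` A.
Proof.
move=> [V nV VA] [x y] exy; apply: VA; rewrite /= (exy : x = y).
by rewrite mulgV; exact: nbhs_singleton.
Qed.

Lemma right_entourage_inv (A : set (G * G)) :
  right_entourage A -> right_entourage (A^-1)%relation.
Proof.
move=> [V nV VA]; exists [set x | V x^-1]; first exact: nbhs1_invg.
by move=> [x y] /= Vxy; apply: VA => /=; rewrite invgM invgK in Vxy.
Qed.

Lemma right_entourage_split_ex A : right_entourage A ->
  exists2 B : set (G * G), right_entourage B & (B \; B `<=` A)%relation.
Proof.
move=> [V /nbhs1_split[W nW WV] VA].
exists [set xy | W (xy.1 * xy.2^-1)]; first by exists W.
move=> [x y] /= [z /= Wxz Wzy]; apply: VA => /=.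
by rewrite -(mulgVK z x) -mulgA; exact: WV.
Qed.

Lemma nbhs_right_entourage : @nbhs G G = nbhs_ (@right_entourage G).
Proof.
apply/funext => x; apply/seteqP; split=> U.
  move=> nU; exists [set xy | U ((xy.1 * xy.2^-1)^-1 * x)].
    exists [set v | U (v^-1 * x)] => //.
    apply: (@nbhs1_invg [set v | U (v * x)]).
    by apply: (@mulgr_continuous x 1); rewrite mul1g.
  by move=> y; rewrite /xsection /= inE /= invgM invgK mulgVK.
move=> [A [V nV VA] AU].
have : nbhs x [set y | V (x * y^-1)].
  have c : {for x, continuous (fun y : G => x * y^-1)}.
    apply: continuous2_mulg; first exact: cst_continuous.
    exact: invg_continuous.
  by apply: c; rewrite mulgV.
apply: filterS => y Vxy; apply: AU; rewrite /xsection /= inE.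
exact: VA.
Qed.

End TopologicalGroupTheory.

(* Copies of G carrying U_l and U_r; as both copies keep the topology of G,
   these instances also check that U_l and U_r induce that topology. *)
Definition left_uniform (G : topGroupType) : Type := G.
Definition right_uniform (G : topGroupType) : Type := G.

HB.instance Definition _ (G : topGroupType) :=
  Topological.copy (left_uniform G) G.
HB.instance Definition _ (G : topGroupType) :=
  Nbhs_isUniform_mixin.Build (left_uniform G)
    left_entourage_filter left_entourage_diagonal left_entourage_inv
    left_entourage_split_ex nbhs_left_entourage.

HB.instance Definition _ (G : topGroupType) :=
  Topological.copy (right_uniform G) G.
HB.instance Definition _ (G : topGroupType) :=
  Nbhs_isUniform_mixin.Build (right_uniform G)
    right_entourage_filter right_entourage_diagonal right_entourage_inv
    right_entourage_split_ex nbhs_right_entourage.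

Definition SIN (G : topGroupType) : Prop :=
  (@entourage (left_uniform G) : set_system (G * G)) =
  (@entourage (right_uniform G) : set_system (G * G)).

(* Omega is retyped as a set in left_uniform G so that set_type Omega carries the
   uniformity induced by U_l. *)
Definition left_unif_continuous (G : topGroupType) (Omega : set G)
    (f : Omega -> G) : Prop :=
  @unif_continuous (set_type (Omega : set (left_uniform G))) (left_uniform G) f.

Lemma left_unif_continuousP (G : topGroupType) (Omega : set G)
    (f : Omega -> G) :
  left_unif_continuous f <->
  forall V, nbhs (1 : G) V -> exists2 W, nbhs (1 : G) W &
    forall x y : Omega, W ((\val x)^-1 * \val y) -> V ((f x)^-1 * f y).
Proof.
split=> [cf V nV|H A [V nV VA]].
  have [|B [W nW WB] BA] := cf [set xy | V (xy.1^-1 * xy.2)].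
    by exists V.
  by exists W => // x y Wxy; apply: (BA (x, y)); exact: (WB (\val x, \val y)).
have [W nW WV] := H V nV.
exists [set xy | W (xy.1^-1 * xy.2)]; first by exists W.
by move=> [x y] /= Wxy; apply: VA; exact: WV.
Qed.

Definition left_thin (G : topGroupType) (A : set G) : Prop :=
  forall V : set G, nbhs 1 V ->
    nbhs 1 (\bigcap_(a in A) [set a^-1 * v * a | v in V]).

Definition Roelcke_discrete (G : topGroupType) (A : set G) : Prop :=
  exists2 V : set G, nbhs 1 V &
    forall a b, A a -> A b -> [set v * b * w | v in V & w in V] a -> a = b.

(* Main.v *)
(* A set U is "good" if w ^ x -> 1 as w -> 1, uniformly in x in U. A maximal
   Roelcke-discrete set Q with respect to a good symmetric neighborhood U of 1
   satisfies G = U Q U, and Q is good by hypothesis; so one good neighborhood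
   suffices for SIN.

   If no neighborhood of 1 is good, one finds by induction on k, at arbitrarily
   small scales V, a good set A and a neighborhood B such that B ^ (a ^+ j) is
   in V for j < k and a in A, whereas w ^ (b * a ^+ k) does not tend to 1 as
   w -> 1. For the step from k to k + 1, consider x = a * b: since
   (a * b) ^+ j is a ^+ j up to a small factor for j <= k, conjugation by
   x ^+ j is harmless for j <= k and x ^+ k.+1 is bad; then replace the set of
   all such x by a maximal Roelcke-discrete subset at a much smaller scale C,
   writing x = s * q * t with s, t in C, a conjugate of q * (t * s).

   For k = p - 2 this is absurd: at x = a * b in Omega, left uniform continuity
   makes x ^- p * (x * w) ^+ p = w ^ (x ^+ p.-1) * ... * w ^ x * w small, and
   so are all factors except the first. *)
Require Import Defs.
Set Warnings "-notation-overridden,-notation-incompatible-prefix".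
From mathcomp Require Import all_boot.
From mathcomp Require Import boolp classical_sets functions topology.

Set Implicit Arguments.
Unset Strict Implicit.
Unset Printing Implicit Defensive.

Local Open Scope classical_set_scope.
Local Open Scope group_scope.

(** * Good sets: equicontinuity of conjugation at 1 *)

Definition conj_equicont {G : topGroupType} (A : set G) : Prop :=
  forall V, nbhs (1 : G) V ->
    exists2 W, nbhs (1 : G) W & forall a w, A a -> W w -> V (w ^ a).

Section ConjugationEquicontinuity.
Context {G : topGroupType}.
Implicit Types (V W X A B : set G) (a b w x : G).

Lemma nbhs1_symmetric V : nbhs (1 : G) V ->
  exists2 W, nbhs (1 : G) W & W `<=` V /\ forall x, W x -> W x^-1.
Proof.
move=> nV; exists (V `&` [set x | V x^-1]).
  by apply: filterI => //; exact: nbhs1_invg.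
by split=> [x []//|x [Vx Vx']]; split=> //=; rewrite invgK.
Qed.

Lemma nbhs1_conjg V : nbhs (1 : G) V ->
  exists2 W, nbhs (1 : G) W & W `<=` V /\ forall w x, W w -> W x ->
    V (w ^ x) /\ V (w ^ x^-1).
Proof.
move=> nV; have [W1 nW1 W1V] := nbhs1_split nV.
have [W2 nW2 W2W1] := nbhs1_split nW1.
have [W nW [WI WJ]] := nbhs1_symmetric (filterI nW1 nW2).
have W1x x : W x -> W1 x by case/WI.
have W2x x : W x -> W2 x by case/WI.
exists W => //; split=> [x Wx|w x Ww Wx].
  by rewrite -[x]mulg1; apply: W1V; [exact: W1x|exact: nbhs_singleton].
by rewrite /conjg invgK; split; apply: W1V; auto.
Qed.

Lemma conj_equicont1 x : conj_equicont [set x].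
Proof.
move=> V nV; exists [set w | V (w ^ x)] => [|a w ->//].
have c : {for 1, continuous (fun w : G => w ^ x)}.
  apply: continuous2_mulg; first exact: cst_continuous.
  exact: mulgr_continuous.
by apply: c; rewrite /= conj1g.
Qed.

Lemma conj_equicont_sub A B : A `<=` B -> conj_equicont B -> conj_equicont A.
Proof.
move=> AB eB V /eB[W nW WV]; exists W => // a w /AB; exact: WV.
Qed.

Lemma conj_equicontM A B : conj_equicont A -> conj_equicont B ->
  conj_equicont [set a * b | a in A & b in B].
Proof.
move=> eA eB V /eB[W /eA[W' nW' W'W] WV]; exists W' => //.
by move=> _ w [a Aa [b Bb <-]] W'w; rewrite conjgM; apply: WV => //; exact: W'W.
Qed.

Lemma conj_equicontX n A V : conj_equicont A -> nbhs (1 : G) V ->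
  exists2 W, nbhs (1 : G) W &
    forall a w j, j <= n -> A a -> W w -> V (w ^ (a ^+ j)).
Proof.
move=> eA; elim: n V => [|n IH] V nV.
  by exists V => // a w [|//] _ _; rewrite expg0 conjg1.
have [W1 nW1 W1V] := IH _ nV; have [W nW WW1] := eA _ nW1.
exists (W `&` V); first exact: filterI.
move=> a w [|j] ltjn Aa [Ww Vw]; first by rewrite expg0 conjg1.
by rewrite expgS conjgM; apply: W1V => //; exact: WW1.
Qed.

(** A point [w] lies in the conjugate of [V] by [a] exactly when [w ^ a^-1] lies in [V], so thinness
    controls conjugation by inverses. *)
Lemma left_thin_conj_equicont A :
  left_thin A -> conj_equicont [set a | A a^-1].
Proof.
move=> tA V /tA nI; eexists; first exact: nI.
move=> a w /= Aa Iw; have [v Vv <-] := Iw _ Aa.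
by rewrite /conjg !gnorm.
Qed.

Lemma Roelcke_discreteV A :
  Roelcke_discrete A -> Roelcke_discrete [set a | A a^-1].
Proof.
move=> [V nV VA]; exists [set x | V x^-1]; first exact: nbhs1_invg.
move=> a b /= Aa Ab [v Vv [w Vw avbw]]; apply: invg_inj; apply: VA => //.
by exists w^-1 => //; exists v^-1 => //; rewrite -avbw !gnorm.
Qed.

(** Zorn's lemma; as [V] is symmetric, a point that cannot be added to a maximal [B] is within [V]
    of some [b], on both sides. *)
Lemma maximal_Roelcke_discrete X V : nbhs (1 : G) V ->
  (forall x, V x -> V x^-1) ->
  exists B, [/\ B `<=` X, Roelcke_discrete B &
    forall x, X x -> exists2 b, B b &
      exists s t, [/\ V s, V t & x = s * b * t]].
Proof.
move=> nV VV; have V1 : V 1 by exact: nbhs_singleton.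
pose P B := B `<=` X /\ forall a b, B a -> B b ->
  [set v * b * w | v in V & w in V] a -> a = b.
have [|B [[BX BV] maxB]] := @Zorn_bigcup _ P.
  move=> F FP totF; split=> [x [B /FP[BX _] /BX//]|a b [A FA Aa] [B FB Bb]].
  have [AB|BA] := totF _ _ FA FB; last by apply: (FP A FA).2 => //; exact: BA.
  by apply: (FP B FB).2 => //; exact: AB.
exists B; split=> //; first by exists V.
move=> x Xx; apply: contrapT => nx.
have nBx : ~ B x.
  by move=> Bx; apply: nx; exists x => //; exists 1, 1; rewrite mul1g mulg1.
apply: (maxB (B `|` [set x])).
  by split=> [|/(_ x)]; [left|move/(_ (or_intror erefl))].
split=> [y [/BX//|->//]|a b [Ba|->] [Bb|->] //].
- exact: BV.
- move=> [s Vs [t Vt asxt]]; exfalso; apply: nx; exists a => //.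
  by exists s^-1, t^-1; split; [exact: VV|exact: VV|rewrite -asxt !gnorm].
- move=> [s Vs [t Vt asxt]]; exfalso; apply: nx; exists b => //.
  by exists s, t.
Qed.

(** [x^-1 * y] is the conjugate of [y * x^-1] by [x]. *)
Lemma conj_equicont_SIN : conj_equicont [set: G] -> SIN G.
Proof.
move=> eG; apply/seteqP; split=> E [V nV VE].
  have [W nW WV] := eG _ nV; exists [set x | W x^-1]; first exact: nbhs1_invg.
  move=> [x y] /= Wxy; apply: VE => /=.
  by have := WV x _ I Wxy; rewrite /conjg !gnorm.
have [W nW WV] := eG _ nV; exists [set x | W x^-1]; first exact: nbhs1_invg.
move=> [x y] /= Wxy; apply: VE => /=.
by have := WV x^-1 _ I Wxy; rewrite /conjg !gnorm.
Qed.

(** * Powers of a perturbed element *)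

Definition powdev n x b : G := (x ^+ n)^-1 * (x * b) ^+ n.

Lemma powdevE n x b : (x * b) ^+ n = x ^+ n * powdev n x b.
Proof. by rewrite /powdev mulVKg. Qed.

(** Iterated, this unfolds [powdev n x b] into the product of [b ^ (x ^+ j)], [j] running from n - 1
    down to 0. *)
Lemma powdevS n x b : powdev n.+1 x b = b ^ (x ^+ n) * powdev n x b.
Proof. by rewrite /powdev /conjg !expgS !gnorm. Qed.

Lemma powdev_small n V : nbhs (1 : G) V ->
  exists2 W, nbhs (1 : G) W & forall x b,
    (forall j, j < n -> W (b ^ (x ^+ j))) ->
    forall j, j <= n -> V (powdev j x b).
Proof.
elim: n V => [|n IH] V nV.
  exists V => // x b _ [|//] _.
  by rewrite /powdev !expg0 invg1 mul1g; exact: nbhs_singleton.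
have [V1 nV1 V1V] := nbhs1_split nV; have [W nW WV1] := IH _ (filterI nV nV1).
exists (W `&` V1); first exact: filterI.
move=> x b sm; have {}WV1 := WV1 x b (fun j ltjn => (sm j (ltnW ltjn)).1).
move=> j; rewrite leq_eqVlt => /predU1P[->|/WV1[]//].
rewrite powdevS; apply: V1V; first by have [] := sm _ (leqnn _).
by have [] := WV1 _ (leqnn n).
Qed.

(** * The obstruction at exponent [k] *)

(* The conjugates w ^ (b * a ^+ k) stay bad at a scale E fixed in advance of V;
   the room A * B * E inside Omega is what lets A be perturbed. *)
Definition power_obstruction (Omega : set G) (k : nat) : Prop :=
  exists2 E, nbhs (1 : G) E & forall V, nbhs (1 : G) V ->
    exists A B : set G, [/\ nbhs (1 : G) B,
      conj_equicont A /\ conj_equicont [set a | A a^-1],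
      forall a b e, A a -> B b -> E e -> Omega (a * b * e),
      forall a b j, j < k -> A a -> B b -> V (b ^ (a ^+ j)) &
      forall W, nbhs (1 : G) W -> exists w a b,
        [/\ W w, A a, B b & ~ E (w ^ (b * a ^+ k))]].

Lemma power_obstruction0 (Omega : set G) : open Omega -> Omega !=set0 ->
  (forall U, nbhs (1 : G) U -> ~ conj_equicont U) -> power_obstruction Omega 0.
Proof.
move=> oO [x0 Ox0] nE.
have nO : nbhs (1 : G) [set u | Omega (x0 * u)].
  by apply: (@mulgl_continuous G x0 1); rewrite mulg1; exact: open_nbhs_nbhs.
have [U nU UO] := nbhs1_split nO.
(* [U] comes from [Omega] alone, so the scale [E] at which it fails to be good precedes [V]. *)
have /existsNP[E /not_implyP[nE0 UE]] := nE _ nU.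
exists (E `&` U); first exact: filterI.
move=> V nV; exists [set x0], U; split=> //.
- split; first exact: conj_equicont1.
  apply: (@conj_equicont_sub _ [set x0^-1]); last exact: conj_equicont1.
  by move=> a /= <-; rewrite invgK.
- by move=> a b e -> Ub [_ Ue]; rewrite -mulgA; exact: UO.
- move=> W nW; apply: contrapT => nex; apply: UE; exists W => // b w Ub Ww.
  apply: contrapT => nEw; apply: nex; exists w, x0, b; split=> //.
  by rewrite expg0 mulg1 => -[].
Qed.

Lemma power_obstructionS (Omega : set G) k :
  (forall A : set G, Roelcke_discrete A -> left_thin A) ->
  power_obstruction Omega k -> power_obstruction Omega k.+1.
Proof.
move=> discrete_thin [E nE badE].
(* [F3], [F2], [F1] absorb in turn the last three conjugations in [key], and [E1] splits the room in
   [Omega]; none may depend on [V]. *)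
have [F1 nF1 [_ F1E]] := nbhs1_conjg nE.
have [F2 nF2 [_ F2F1]] := nbhs1_conjg nF1.
have [F3 nF3 [F3F2 F3J]] := nbhs1_conjg nF2.
have [E1 nE1 E1E] := nbhs1_split nE.
exists (F3 `&` E1); first exact: filterI.
move=> V nV.
have [D nD Dsmall] := powdev_small k.+1 nF3.
have [V1 nV1 [_ V1VD]] := nbhs1_conjg (filterI nV nD).
have [U nU Usmall] := powdev_small k (filterI nF1 nV1).
have [A [B [nB [eA eAV] ABO ABU badA]]] := badE _ nU.
have [Z nZ ZV1] := conj_equicontX k eA nV1.
have [Y nY YZ] := nbhs1_split nZ.
have [C nC [CI CV]] := nbhs1_symmetric
  (filterI (filterI nZ nY) (filterI nF2 nE1)).
have {CI} [CZ CY CF2 CE1] : [/\ C `<=` Z, C `<=` Y, C `<=` F2 & C `<=` E1].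
  by split=> c /CI[[? ?] [? ?]].
pose X := [set a * b | a in A & b in B].
have XP a b : A a -> B b -> forall j, j <= k ->
    (F1 `&` V1) (powdev j a b).
  by move=> Aa Bb; apply: Usmall => j ltjk; exact: ABU.
(* Conjugation by [x ^+ j] is conjugation by [a ^+ j], then by the small [powdev j a b]. *)
have XZ x z j : X x -> Z z -> j <= k -> (V `&` D) (z ^ (x ^+ j)).
  move=> [a Aa [b Bb <-]] Zz lejk; rewrite powdevE conjgM.
  have [_ V1d] := XP _ _ Aa Bb _ lejk.
  by case: (V1VD _ _ (ZV1 _ _ _ lejk Aa Zz) V1d).
have [Q [QX dQ XQ]] := maximal_Roelcke_discrete X nC CV.
exists Q, C; split=> //.
- split; last exact/left_thin_conj_equicont/discrete_thin.
  have := left_thin_conj_equicont (discrete_thin _ (Roelcke_discreteV dQ)).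
  by apply: conj_equicont_sub => a /=; rewrite invgK.
- move=> _ c e /QX[a Aa [b Bb <-]] Cc [_ E1e]; rewrite -[_ * c * e]mulgA.
  by apply: ABO => //; apply: E1E => //; exact: CE1.
- by move=> q c j ltjk /QX Xq /CZ Zc; have [] := XZ _ _ _ Xq Zc ltjk.
move=> W nW; have [W1 nW1 W1W] := eAV _ nW.
have [u [a [b [W1u Aa Bb nEu]]]] := badA _ nW1.
have Xx : X (a * b) by exists a => //; exists b.
have [q Qq [s [t [Cs Ct xE]]]] := XQ _ Xx.
(* Conjugating [u ^ a^-1] by [a * b * a ^+ k] gives [u ^ (b * a ^+ k)], and [a * b * a ^+ k] is
   [(a * b) ^+ k.+1] up to [powdev k a b]. *)
exists (u ^ a^-1), q, s; split=> //; first by apply: W1W; rewrite //= invgK.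
move=> [F3w _]; apply: nEu.
have [F1d _] := XP _ _ Aa Bb _ (leqnn k).
have F3d : F3 (powdev k.+1 q (t * s)).
  apply: Dsmall => // j ltjk; have Zts := YZ _ _ (CY _ Ct) (CY _ Cs).
  by have [] := XZ _ _ _ (QX _ Qq) Zts ltjk.
have xE' : a * b = (q * (t * s)) ^ s^-1 by rewrite xE /conjg !gnorm.
(* Compute [(a * b) ^+ k.+1] twice, from [a] and, through [xE'], from [q]; then solve for
   [b * a ^+ k]. *)
have key : u ^ (b * a ^+ k) = ((((u ^ a^-1) ^ (s * q ^+ k.+1))
    ^ powdev k.+1 q (t * s)) ^ s^-1) ^ (powdev k a b)^-1.
  rewrite -!conjgM; congr (_ ^ _).
  have : (a * b) ^+ k.+1 = s * q ^+ k.+1 * powdev k.+1 q (t * s) * s^-1.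
    by rewrite xE' -conjXg powdevE /conjg !gnorm.
  rewrite expgS powdevE; move: (powdev k a b) (powdev k.+1 q _) => d d'.
  by move=> /(congr1 (fun z => a^-1 * z * d^-1)); rewrite !gnorm.
rewrite key; have [F2w _] := F3J _ _ F3w F3d.
have [_ F1w] := F2F1 _ _ F2w (CF2 _ Cs).
by have [] := F1E _ _ F1w F1d.
Qed.

Lemma power_obstruction_not_luc (Omega : set G) k :
  (forall V, nbhs (1 : G) V -> exists2 W, nbhs (1 : G) W &
    forall x w, Omega x -> Omega (x * w) -> W w -> V (powdev k.+2 x w)) ->
  ~ power_obstruction Omega k.
Proof.
move=> luc [E nE badE].
have [F1 nF1 [_ F1E]] := nbhs1_conjg nE.
have [F2 nF2 F2F1] := nbhs1_split nF1.
have [F nF [FF2 FV]] := nbhs1_symmetric nF2.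
have [L nL Lluc] := luc _ nF.
have [D nD Dsmall] := powdev_small k.+1 nF.
have [V1 nV1 [_ V1D]] := nbhs1_conjg nD.
have [U nU Usmall] := powdev_small k (filterI nF1 nV1).
have [A [B [nB [eA eAV] ABO ABU badA]]] := badE _ nU.
have [Z nZ ZV1] := conj_equicontX k eA nV1.
(* [u ^ a^-1] must lie in [Z] for small conjugates, in [E] to keep [a * b * w] in [Omega], and in
   [L] for uniform continuity. *)
have [W nW WI] := eAV _ (filterI (filterI nZ nE) nL).
have [u [a [b [Wu Aa Bb nEu]]]] := badA _ nW; apply: nEu.
have [[Zw Ew] Lw] : (Z `&` E `&` L) (u ^ a^-1) by apply: WI; rewrite //= invgK.
set w := u ^ a^-1 in Zw Ew Lw.
have XP j : j <= k -> (F1 `&` V1) (powdev j a b).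
  by apply: Usmall => i ltik; exact: ABU.
have Fd : F (powdev k.+1 (a * b) w).
  apply: Dsmall => // j lejk; rewrite powdevE conjgM.
  have [_ V1d] := XP _ lejk.
  by have [] := V1D _ _ (ZV1 _ _ _ lejk Aa Zw) V1d.
have Fd' : F (powdev k.+2 (a * b) w).
  apply: Lluc => //; last exact: ABO.
  by rewrite -[a * b]mulg1; apply: ABO => //; exact: nbhs_singleton.
(* By [powdevS] this conjugate is the quotient of two small deviations, at exponents [k.+2] and
   [k.+1]. *)
have F1w : F1 (w ^ ((a * b) ^+ k.+1)).
  rewrite -[_ ^ _](mulgK (powdev k.+1 (a * b) w)) -powdevS.
  by apply: F2F1; apply: FF2 => //; exact: FV.
have [F1d _] := XP _ (leqnn k).
suff -> : u ^ (b * a ^+ k) = (w ^ ((a * b) ^+ k.+1)) ^ (powdev k a b)^-1.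
  by have [] := F1E _ _ F1w F1d.
by rewrite /w -!conjgM expgS powdevE !gnorm.
Qed.

End ConjugationEquicontinuity.

Theorem theorem3p4 (G : topGroupType) (hausdorffG : hausdorff_space G)
    (p : nat) (p_ge2 : (2 <= p)%N)
    (Omega : set G) (Omega_open : open Omega) (Omega_nonempty : Omega !=set0)
    (power_luc : left_unif_continuous (fun g : Omega => (\val g : G) ^+ p))
    (discrete_thin : forall A : set G, Roelcke_discrete A -> left_thin A) :
  SIN G.
Proof.
have [[U nU eU]|nU] := pselect (exists2 U, nbhs (1 : G) U & conj_equicont U).
  have [C nC [CU CV]] := nbhs1_symmetric nU.
  have [Q [_ dQ GQ]] := maximal_Roelcke_discrete setT nC CV.
  have eC := conj_equicont_sub CU eU.
  have eQ : conj_equicont Q.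
    have := left_thin_conj_equicont (discrete_thin _ (Roelcke_discreteV dQ)).
    by apply: conj_equicont_sub => a /=; rewrite invgK.
  apply: conj_equicont_SIN.
  apply: conj_equicont_sub (conj_equicontM (conj_equicontM eC eQ) eC).
  move=> x _; have [q Qq [s [t [Cs Ct ->]]]] := GQ x I.
  by exists (s * q); [exists s => //; exists q|exists t].
exfalso; case: p p_ge2 power_luc => [|[|k]]// _ luc.
have bad : power_obstruction Omega k.
  elim: k {luc} => [|k IH]; last exact: power_obstructionS.
  by apply: power_obstruction0 => // U nbU eU; apply: nU; exists U.
apply: power_obstruction_not_luc bad => V nV.
have [W nW WV] := (left_unif_continuousP _).1 luc _ nV.
exists W => // x w Ox Oxw Ww; rewrite /powdev.
have Ox' : x \in Omega by rewrite inE.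
have Oxw' : x * w \in Omega by rewrite inE.
(* The left difference of [x] and [x * w] is [w]. *)
by apply: (WV (SigSub Ox') (SigSub Oxw')); rewrite /= mulKg.
Qed.
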